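(* Let $k \ge 2$ be an integer and let $\mathcal{F}_k$ be the free group on $k$ generators, with a finite generating set $S$. Then $F_{\mathcal{F}_k}^S(n) \succeq n^{2/3}$; that is, there exists a positive integer $C$ such that $n^{2/3} \le C\, F_{\mathcal{F}_k}^S(Cn)$ for all integers $n \ge 1$.
   Context: For a residually finite group $G$ and $w \in G$, $w \ne 1$, define $$k_G(w) := \min\{\,|H| \;:\; H \text{ is a finite group and there exists a homomorphism } \pi: G \to H \text{ with } \pi(w) \ne 1\,\}.$$ For a finite generating set $S$ of $G$, let $|w|_S$ denote the word length of $w$ with respect to $S$ (letters from $S \cup S^{-1}$), and define $$F_G^S(n) := \max\{\,k_G(w) \;:\; w \in G,\ w \ne 1,\ |w|_S \le n\,\}.$$ For functions $f_1, f_2$, write $f_1 \preceq f_2$ if there exists $C$ such that $f_1(n) \le C f_2(Cn)$ for all $n$; $f_2 \succeq f_1$ means $f_1 \preceq f_2$. Up to the induced equivalence, $F_G^S$ does not depend on the finite generating set $S$, and the paper writes $F_G$ for it. *)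

(* Defs.v *)
From HB Require Import structures.
From mathcomp Require Import all_boot all_order all_algebra all_fingroup.
From mathcomp Require Import all_classical all_reals exp.

Set Implicit Arguments.
Unset Strict Implicit.
Unset Printing Implicit Defensive.

Local Open Scope classical_set_scope.
Local Open Scope group_scope.

(* Free group of rank k, as the set of reduced words.  The letter (i, false)
   is the i-th generator and (i, true) its inverse. *)
Section FreeGroup.
Variable k : nat.

Definition letter : Type := ('I_k * bool)%type.
Implicit Types (a b : letter) (s t : seq letter).

Definition linv a : letter := (a.1, ~~ a.2).

Definition reduced s : bool := sorted (fun a b => b != linv a) s.

Record free_group := FreeGroup { fg_word :> seq letter; _ : reduced fg_word }.

HB.instance Definition _ := [isSub for fg_word].
HB.instance Definition _ := [Countable of free_group by <:].

Lemma fg_reduced (u : free_group) : reduced u.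
Proof. exact: valP. Qed.

Lemma linvK : involutive linv.
Proof. by case=> i b; rewrite /linv /= negbK. Qed.

Definition lmul a s : seq letter :=
  if s is b :: s' then if b == linv a then s' else a :: s else [:: a].

Lemma lmul_reduced a s : reduced s -> reduced (lmul a s).
Proof.
case: s => //= b s sP; case: ifP => [_|/negbT ab]; last by rewrite /reduced /= ab.
exact: path_sorted sP.
Qed.

Lemma lmulK a s : reduced s -> lmul (linv a) (lmul a s) = s.
Proof.
case: s => [|b s] /=; first by rewrite linvK eqxx.
move=> sP; case: eqP => [ba|_]; last by rewrite /= linvK eqxx.
case: s sP => [|c s] /=; first by rewrite ba.
by rewrite -ba; case: eqP => //= ->; rewrite eqxx.
Qed.

Definition rmul s t : seq letter := foldr lmul t s.

Lemma rmul_reduced s t : reduced t -> reduced (rmul s t).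
Proof. by move=> tP; elim: s => //= a s; apply: lmul_reduced. Qed.

Lemma rmul_lmul a s t : reduced s -> reduced t ->
  rmul (lmul a s) t = lmul a (rmul s t).
Proof.
case: s => //= b s sP tP; case: eqP => //= ->.
rewrite -{1}[a]linvK lmulK //; exact: rmul_reduced.
Qed.

Lemma rmulA s t u : reduced t -> reduced u ->
  rmul s (rmul t u) = rmul (rmul s t) u.
Proof.
move=> tP uP; elim: s => //= a s ->.
by rewrite rmul_lmul //; apply: rmul_reduced.
Qed.

Lemma rmul0 s : reduced s -> rmul s [::] = s.
Proof.
elim: s => //= a s IHs sP; rewrite IHs; last exact: path_sorted sP.
by case: s sP {IHs} => //= b s /andP[/negbTE ->].
Qed.

Definition rinv s : seq letter := rev (map linv s).

Lemma rinv_reduced s : reduced s -> reduced (rinv s).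
Proof.
rewrite /reduced /rinv rev_sorted sorted_map; apply: sub_sorted => a b /=.
by apply: contra => /eqP ->; rewrite linvK.
Qed.

Lemma rmul_cat s t u : rmul (s ++ t) u = rmul s (rmul t u).
Proof. by rewrite /rmul foldr_cat. Qed.

Lemma rinvK : involutive rinv.
Proof.
by move=> s; rewrite /rinv map_rev revK -map_comp map_id_in // => a _; exact: linvK.
Qed.

Lemma rmulKV s t : reduced t -> rmul (rinv s) (rmul s t) = t.
Proof.
move=> tP; elim: s => //= a s IHs.
rewrite /rinv /= rev_cons -cats1 rmul_cat /= lmulK //; exact: rmul_reduced.
Qed.

Definition fg_one : free_group := @FreeGroup [::] isT.
Definition fg_mul (u v : free_group) : free_group :=
  FreeGroup (rmul_reduced u (fg_reduced v)).
Definition fg_inv (u : free_group) : free_group :=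
  FreeGroup (rinv_reduced (fg_reduced u)).

Lemma fg_mulA : associative fg_mul.
Proof. by move=> u v w; apply: val_inj; rewrite /= rmulA // fg_reduced. Qed.

Lemma fg_mul1 : left_id fg_one fg_mul.
Proof. by move=> u; apply: val_inj. Qed.

Lemma fg_mulg1 : right_id fg_one fg_mul.
Proof. by move=> u; apply: val_inj; rewrite /= rmul0 // fg_reduced. Qed.

Lemma fg_mulV : left_inverse fg_one fg_inv fg_mul.
Proof.
by move=> u; apply: val_inj; rewrite /= -{2}[fg_word u]rmul0 ?fg_reduced // rmulKV.
Qed.

Lemma fg_mulgV : right_inverse fg_one fg_inv fg_mul.
Proof.
move=> u; have {1}<- : fg_inv (fg_inv u) = u by apply: val_inj; rewrite /= rinvK.
exact: fg_mulV.
Qed.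

HB.instance Definition _ := isGroup.Build free_group
  fg_mulA fg_mul1 fg_mulg1 fg_mulV fg_mulgV.

Definition fg_gen (i : 'I_k) : free_group := @FreeGroup [:: (i, false)] isT.

End FreeGroup.

(* Sanity check: free_group k is free on fg_gen. *)
Section UniversalProperty.
Variables (k : nat) (H : groupType) (f : 'I_k -> H).

Definition letter_val (a : letter k) : H := if a.2 then (f a.1)^-1 else f a.1.

Definition fg_lift (u : free_group k) : H := \prod_(a <- u) letter_val a.

Lemma fg_lift_mul (u v : free_group k) : fg_lift (u * v) = fg_lift u * fg_lift v.
Proof.
have lV a : letter_val (linv a) = (letter_val a)^-1.
  by case: a => i []; rewrite /letter_val /= ?invgK.
have lC a s : \prod_(b <- lmul a s) letter_val b
            = letter_val a * \prod_(b <- s) letter_val b.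
  case: s => [|b s] /=; first by rewrite big_seq1 big_nil mulg1.
  by case: eqP => [->|_]; rewrite !big_cons // lV mulgA mulgV mul1g.
rewrite /fg_lift /=; elim: (fg_word u) => [|a s IHs] /=; first by rewrite big_nil mul1g.
by rewrite lC IHs big_cons mulgA.
Qed.

HB.instance Definition _ := isMultiplicative.Build _ _ fg_lift fg_lift_mul.

Lemma fg_lift_gen i : fg_lift (fg_gen i) = f i.
Proof. by rewrite /fg_lift big_seq1. Qed.

Lemma fg_lift_unique (g : {multiplicative free_group k -> H}) :
  (forall i, g (fg_gen i) = f i) -> g =1 fg_lift.
Proof.
move=> gf; have g1 : g 1 = 1 by apply: (mulgI (g 1)); rewrite -gmulfM !mulg1.
have gS (a : letter k) s (sP : reduced s) (asP : reduced (a :: s)) :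
    g (FreeGroup asP) = letter_val a * g (FreeGroup sP).
  case: a asP => i [] asP; rewrite /letter_val /=; last first.
    rewrite -gf -gmulfM; congr (g _); apply: val_inj => /=.
    by case: s asP {sP} => //= b s /andP[/negbTE ->].
  apply: (mulgI (f i)); rewrite mulVKg -gf -gmulfM; congr (g _).
  by apply: val_inj; rewrite /= /linv /= eqxx.
case=> s; rewrite /fg_lift /=; elim: s => [|a s IHs] sP.
  by rewrite big_nil -g1; congr (g _); apply: val_inj.
by rewrite (gS _ _ (path_sorted sP)) IHs big_cons.
Qed.
End UniversalProperty.

(* The value is 0 when the minimum (resp. maximum) does not exist. *)
Definition nat_min (A : set nat) : nat := xget 0 (A `&` lbound A).
Definition nat_max (A : set nat) : nat := xget 0 (A `&` ubound A).

Section Growth.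
Variable G : groupType.
Implicit Types (S : set G) (w g : G).

Definition word_over S (s : seq G) : Prop := {in s, forall x, S x \/ S x^-1}.

Definition word_lengths S g : set nat :=
  [set l | exists s : seq G,
     [/\ size s = l, word_over S s & \prod_(x <- s) x = g]].

Definition generates S : Prop := forall g, word_lengths S g !=set0.

Definition word_length S g : nat := nat_min (word_lengths S g).

(* Orders of the finite groups receiving a homomorphism from G that does not
   kill w.  A multiplicative map between groups preserves 1. *)
Definition detecting_orders w : set nat :=
  [set m | exists (H : finGroupType) (pi : {multiplicative G -> H}),
     #|H| = m /\ pi w <> 1].

(* k_G(w); the set is nonempty for every w <> 1 iff G is residually finite,
   as free groups are. *)
Definition detection w : nat := nat_min (detecting_orders w).

(* F_G^S(n); for S finite and generating, only finitely many w occur, so the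
   maximum exists unless there is no such w, in which case the value is 0. *)
Definition rf_growth S (n : nat) : nat :=
  nat_max [set detection w | w in [set w | w <> 1 /\ (word_length S w <= n)%N]].

End Growth.

(* Main.v *)
(* Pigeonhole: if |H| < (m + 1)^2 and x, y lie in H, then x^i commutes with
   y x y^-1 for some 1 <= i <= m.  In the free group take m = 2^d and form the
   balanced tree of (conjugated) commutators whose leaves are
   [a^i, b a b^-1] for 1 <= i <= m: the resulting word W is killed by every
   homomorphism to a group of order at most 4^d, because one leaf is.  Each of
   the d levels multiplies the length by about 4 and the leaves have length
   O(2^d), so W has length O(8^d).  The commutators are arranged so that no
   letters cancel, hence W <> 1.  Residual finiteness is needed as well, to make
   the minimum and maximum in the definition of the growth function exist. *)
Require Import Defs.
From mathcomp Require Import all_boot all_order all_algebra all_fingroup.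
From mathcomp Require Import all_classical all_reals exp.
From mathcomp Require Import zify ring.

Set Implicit Arguments.
Unset Strict Implicit.
Unset Printing Implicit Defensive.

Local Open Scope group_scope.

(* Pigeonhole on the products [x ^+ i * z ^+ j] with [z] the conjugate of [x]:
   a coincidence either makes a power of [x] a power of [z], or is a relation
   on [z] alone and hence on [x]. *)
Lemma exists_expg_commute (H : finGroupType) (m : nat) (x y : H) :
  (#|H| < m.+1 ^ 2)%N ->
  exists2 i, (0 < i <= m)%N & commute (x ^+ i) (y * x * y^-1).
Proof.
move=> ltH; set z := y * x * y^-1.
have /injectivePn[[i j] [[i' j'] neq eqf]] :
    ~~ injectiveb (fun p : 'I_m.+1 * 'I_m.+1 => x ^+ p.1 * z ^+ p.2).
  apply/negP => /injectiveP /leq_card.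
  by rewrite card_prod !card_ord mulnn leqNgt ltH.
wlog le_i : i j i' j' neq eqf / (i <= i')%N.
  move=> IH; have [|/ltnW] := leqP i i'; first exact: IH neq eqf.
  by apply: (IH i' j' i j); rewrite // eq_sym.
move: neq eqf; rewrite /= xpair_eqE.
have [eq_i /= neq_j eqf | neq_i _ eqf] := eqVneq i i'.
  have {eqf} eqz : z ^+ j = z ^+ j' by apply: (mulgI (x ^+ i)); rewrite eqf eq_i.
  wlog lt_j : j j' neq_j eqz / (j < j')%N.
    move=> IH; have [] := ltngtP j j'; first exact: IH.
      by apply: IH; rewrite 1?eq_sym.
    by move=> /ord_inj /eqP; rewrite (negPf neq_j).
  exists (j' - j)%N; first by have := ltn_ord j'; lia.
  suff -> : x ^+ (j' - j) = 1 by exact/commute_sym/commute1.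
  have zX n : z ^+ n = y * x ^+ n * y^-1.
    have -> : z = x ^ y^-1 by rewrite conjgE invgK mulgA.
    by rewrite -conjXg conjgE invgK mulgA.
  have : z ^+ (j' - j) = 1.
    apply: (mulgI (z ^+ j)); rewrite -expgnDr subnKC ?mulg1 -?eqz //; exact: ltnW.
  rewrite zX => /(canRL (mulgK _)); rewrite mul1g invgK -{2}[y]mulg1.
  exact: mulgI.
exists (i' - i)%N; first by have := ltn_ord i'; move: neq_i; rewrite -val_eqE /=; lia.
suff -> : x ^+ (i' - i) = z ^+ j * z ^- j'.
  apply/commute_sym; apply: commuteM; first exact: commuteX.
  exact/commuteV/commuteX.
apply: (mulgI (x ^+ i)); rewrite -expgnDr subnKC // mulgA eqf mulgK //.
Qed.

(** * Trees of commutators and their vanishing in small finite groups *)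

Section CommutatorTree.
Variable G : groupType.
Implicit Types a b u v : G.

(* [cword a b u v] is [a [u, b v b^-1] a^-1], bracketed to the right; [a] and
   [b] make the product reduced when they are free generators. *)
Definition cword a b u v : G :=
  a * (u * (b * (v * (b^-1 * (u^-1 * (b * (v^-1 * (b^-1 * a^-1)))))))).

Lemma cword_eq1 a b u v : commute u (b * v * b^-1) -> cword a b u v = 1.
Proof.
move=> cuv; set y := b * v * b^-1 in cuv.
have -> : cword a b u v = a * (u * y * u^-1 * y^-1) * a^-1.
  by rewrite /cword /y !invgM !invgK !mulgA.
by rewrite cuv mulgK mulgV mulg1 mulgV.
Qed.

Lemma cword1 a b v : cword a b 1 v = 1.
Proof. by apply: cword_eq1; apply/commute_sym/commute1. Qed.

Lemma cwordr1 a b u : cword a b u 1 = 1.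
Proof. by apply: cword_eq1; rewrite mulg1 mulgV; apply: commute1. Qed.

(** The [2 ^ d] leaves carry the exponents [r + 1, ..., r + 2 ^ d] of [a]; the shift by one avoids
    the trivial exponent 0. *)
Fixpoint ctree a b (d r : nat) : G :=
  if d is d'.+1 then cword a b (ctree a b d' r) (ctree a b d' (r + 2 ^ d')%N)
  else cword a b (a ^+ r.+1) a.

(** One trivial leaf kills the root, since a commutator with a trivial entry is trivial. *)
Lemma ctree_eq1 a b d r i :
  (r <= i < r + 2 ^ d)%N -> commute (a ^+ i.+1) (b * a * b^-1) ->
  ctree a b d r = 1.
Proof.
move=> ri cab; elim: d r ri => [|d IHd] r /= ri.
  by have <- : i = r by [lia]; exact: cword_eq1.
move: ri; rewrite expnS => ri; have [lt_i|le_i] := ltnP i (r + 2 ^ d).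
  by rewrite IHd ?cword1 // lt_i; case/andP: ri => ->.
by rewrite (IHd (r + _)%N) ?cwordr1 //; lia.
Qed.
End CommutatorTree.

Lemma ctree_morph (G H : groupType) (f : {multiplicative G -> H}) a b d r :
  f (ctree a b d r) = ctree (f a) (f b) d r.
Proof.
have f1 : f 1 = 1 by apply: (mulgI (f 1)); rewrite -gmulfM !mulg1.
have fV x : f x^-1 = (f x)^-1 by apply: (mulgI (f x)); rewrite -gmulfM !mulgV.
have fX x n : f (x ^+ n) = f x ^+ n.
  by elim: n => // n IHn; rewrite !expgS gmulfM IHn.
have fC u v : f (cword a b u v) = cword (f a) (f b) (f u) (f v).
  by rewrite /cword !gmulfM !fV.
by elim: d r => [|d IHd] r; rewrite [LHS]fC ?IHd ?fX.
Qed.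

Lemma ctree_finite_eq1 (H : finGroupType) (a b : H) d :
  (#|H| <= 4 ^ d)%N -> ctree a b d 0 = 1.
Proof.
move=> leH; have [|[|i] // i_le cab] := @exists_expg_commute H (2 ^ d) a b.
  (* Here [4 ^ d = (2 ^ d) ^ 2 < (2 ^ d).+1 ^ 2]. *)
  by move: leH; rewrite -[4%N]/(2 ^ 2)%N expnAC; lia.
exact: ctree_eq1 cab.
Qed.

(** * Absence of cancellation in the tree over free generators *)

Section Nontriviality.
Variable k : nat.
Implicit Types (x y : letter k) (s t : seq (letter k)) (i j : 'I_k).

Definition uncancelled x y := y != linv x.

Lemma uncancelled_neq x y : x.1 != y.1 -> uncancelled x y.
Proof. by apply: contraNneq => ->. Qed.

(** Such a word can be flanked by letters of any other generator without cancellation, and so can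
    its inverse. *)
Definition framed_by i s : bool :=
  if s is x :: s' then
    [&& path uncancelled x s', x.1 == i & (last x s').1 == i]
  else false.

Lemma framed_by_rinv i s : framed_by i s -> framed_by i (rinv s).
Proof.
case: s => // x s /and3P[red_s xi lasti].
have: reduced (rinv (x :: s)) by apply: rinv_reduced.
have: (head x (rinv (x :: s))).1 == i.
  by rewrite /rinv -map_rev -nth0 (nth_map x) ?size_rev // nth_rev //=
    subn1 nth_last.
have: (last x (rinv (x :: s))).1 == i.
  by rewrite /rinv /= rev_cons last_rcons.
by rewrite /rinv /= rev_cons; case: (rev _) => [|y t] l h red; apply/and3P; split.
Qed.

Lemma path_framed_by i x y s t :
  framed_by i s -> x.1 != i -> y.1 != i ->
  path uncancelled x (s ++ y :: t) = path uncancelled y t.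
Proof.
case: s => // z s /and3P[red_s /eqP zi /eqP lasti] xi yi.
rewrite /= cat_path /= red_s !uncancelled_neq //; first by rewrite lasti eq_sym.
by rewrite zi.
Qed.

(** In [cword] only the junction of [a] with [u] joins letters of the same generator, so the sign of
    the first letter must be recorded too. *)
Definition starts_at i (u : free_group k) : bool :=
  (ohead u == Some (i, false)) && framed_by i u.

Lemma starts_at_cword i j (u v : free_group k) :
  i != j -> starts_at i u -> starts_at i v ->
  starts_at i (cword (fg_gen i) (fg_gen j) u v).
Proof.
move=> ij /andP[hu bu] /andP[_ bv].
set w := [:: (i, false)] ++ u ++ [:: (j, false)] ++ v ++ [:: (j, true)] ++
  rinv u ++ [:: (j, false)] ++ rinv v ++ [:: (j, true)] ++ [:: (i, true)].
have bw : framed_by i w.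
  rewrite /w /= !(last_cat, last_cons) /= eqxx !andbT.
  case: (fg_word u) hu bu => // x s /eqP[->] bs.
  case/and3P: (bs) => ps _ /eqP ls.
  have ji : j != i by rewrite eq_sym.
  have ii : uncancelled (i, false) (i, false) by rewrite /uncancelled xpair_eqE andbF.
  rewrite /= cat_path ps /= ii !(@path_framed_by i) ?framed_by_rinv //=.
  by rewrite !uncancelled_neq //= ls.
have red_w : reduced w by case/and3P: bw.
(* As [w] is reduced, multiplying its pieces cancels nothing. *)
have -> : cword (fg_gen i) (fg_gen j) u v = FreeGroup red_w.
  by apply: val_inj; rewrite /= -[RHS](rmul0 red_w) /w !rmul_cat.
by apply/andP; split; [exact: eqxx | exact: bw].
Qed.

Lemma starts_at_expg i r : starts_at i (fg_gen i ^+ r.+1).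
Proof.
have wX n : fg_word (fg_gen i ^+ n) = nseq n (i, false).
  elim: n => // n IHn; rewrite expgS /= IHn /=.
  by case: n {IHn} => //= n; rewrite /linv /= xpair_eqE andbF.
rewrite /starts_at wX /=.
elim: r => [|r IHr] /=; first by rewrite !eqxx.
have -> : uncancelled (i, false) (i, false) by rewrite /uncancelled xpair_eqE andbF.
exact: IHr.
Qed.

Lemma starts_at_ctree i j d r :
  i != j -> starts_at i (ctree (fg_gen i) (fg_gen j) d r).
Proof.
move=> ij; elim: d r => [|d IHd] r /=; apply: starts_at_cword => //.
  exact: starts_at_expg.
exact: (starts_at_expg i 0).
Qed.

Lemma ctree_gen_neq1 i j d r : i != j -> ctree (fg_gen i) (fg_gen j) d r <> 1.
Proof.
move=> ij w1; have := starts_at_ctree d r ij.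
by rewrite w1.
Qed.
End Nontriviality.

(** * Residual finiteness of free groups *)

(** A permutation that is right on [D :\ x] is corrected at [x] by swapping [p x] and [f x], neither
    of which is the image of another point of [D]. *)
Lemma perm_extension (T : finType) (D : {set T}) (f : T -> T) :
  {in D &, injective f} -> exists p : {perm T}, {in D, p =1 f}.
Proof.
have [n le_n] := ubnP #|D|; elim: n D le_n => // n IHn D le_n injf.
have [->|[x Dx]] := set_0Vmem D; first by exists 1 => y; rewrite inE.
have [||p pf] := IHn (D :\ x).
- by move: le_n; rewrite (cardsD1 x) Dx.
- by move=> y z /setD1P[_ Dy] /setD1P[_ Dz]; apply: injf.
exists (p * tperm (p x) (f x)) => y Dy; rewrite permM.
have [->|neq_yx] := eqVneq y x; first by rewrite tpermL.
have py : p y = f y by apply: pf; rewrite !inE neq_yx.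
rewrite tpermD ?py //; last by rewrite (inj_in_eq injf) // eq_sym.
by rewrite -py (inj_eq perm_inj) eq_sym.
Qed.

(* The letters of [w] prescribe partial injections of [0, ..., size w] under
   which [w], acting on the right, carries [0] to [size w]. *)
Lemma free_group_detection (k : nat) (w : free_group k) :
  w <> 1 -> detecting_orders w (size w).+1`!.
Proof.
move=> w1; set l := size w.
have [x0 _] : exists x0 : letter k, True.
  case E : (fg_word w) => [|x s]; last by exists x.
  by case: w1; apply: val_inj.
have red n : (n.+1 < l)%N -> nth x0 w n.+1 != linv (nth x0 w n).
  by have /(sortedP x0) := fg_reduced w; apply.
(* Generator [i] must send [x] to [x.+1] if letter [x] is that generator, and [x] to [x.-1] if
   letter [x.-1] is its inverse. *)
pose fwd i (x : 'I_l.+1) := (x < l)%N && (nth x0 w x == (i, false)).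
pose bwd i (x : 'I_l.+1) := (0 < x)%N && (nth x0 w x.-1 == (i, true)).
pose f i (x : 'I_l.+1) : 'I_l.+1 := inord (if fwd i x then x.+1 else x.-1).
(* If [x] and [x.+2] were both sent to [x.+1], letters [x] and [x.+1] would cancel. *)
have fwd_bwd i (x y : 'I_l.+1) : fwd i x -> bwd i y -> y != x.+2 :> nat.
  move=> /andP[_ /eqP xi] /andP[_ /eqP yi]; apply/eqP => yx; rewrite yx /= in yi.
  by have := red x; rewrite yi xi -ltnS -yx ltn_ord eqxx => /(_ isT).
have val_f i x : nat_of_ord (f i x) = if fwd i x then x.+1 else x.-1.
  by rewrite inordK //; case: ifP => [/andP[]|_] //; have := ltn_ord x; lia.
have /choice[p pf] i : exists p : {perm 'I_l.+1},
    {in [set x | fwd i x || bwd i x], p =1 f i}.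
  apply: perm_extension => x y; rewrite !inE => Dx Dy /(congr1 val) /=.
  rewrite !val_f => eq_f; apply/val_inj => /=; move: Dx Dy eq_f.
  have [fx|_] := boolP (fwd i x); have [fy|_] := boolP (fwd i y) => //=.
  - by move=> _ _ [].
  - by move=> _ bwy; have := fwd_bwd _ _ _ fx bwy; case/andP: bwy; lia.
  - by move=> bwx _; have := fwd_bwd _ _ _ fy bwx; case/andP: bwx; lia.
  - by move=> /andP[? _] /andP[? _]; lia.
have move_nth n : (n < l)%N -> letter_val p (nth x0 w n) (inord n) = inord n.+1.
  move=> lt_n; case E : (nth x0 w n) => [i []] /=; rewrite /letter_val /=.
    apply: (canLR (permK _)).
    have bn : bwd i (inord n.+1) by rewrite /bwd inordK //= E eqxx.
    rewrite pf ?inE ?bn ?orbT //; apply: ord_inj.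
    rewrite val_f /= [in RHS]inordK ?inordK // 1?ltnW //.
    (* Were both prescriptions active at [n.+1], letters [n] and [n.+1] would cancel. *)
    case: ifP => // /andP[]; rewrite inordK // => lt_n1.
    by have := red n lt_n1; rewrite E => /negPf->.
  have fn : fwd i (inord n) by rewrite /fwd inordK ?E ?eqxx ?lt_n // ltnW.
  by rewrite pf ?inE ?fn // /f fn inordK // ltnW.
have move_take n : (n <= l)%N ->
    (\prod_(x <- take n w) letter_val p x) ord0 = inord n.
  elim: n => [|n IHn] le_n.
    by rewrite take0 big_nil perm1; apply: val_inj; rewrite /= inordK.
  by rewrite (take_nth x0) // big_rcons /= permM IHn ?move_nth // ltnW.
exists {perm 'I_l.+1}, (fg_lift p); split; first by rewrite card_Sn.
move=> pw1; have := move_take l (leqnn l).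
rewrite take_size -/(fg_lift p w) pw1 perm1 => /(congr1 val) /=.
rewrite inordK // => /esym/size0nil w0.
by apply: w1; apply: val_inj.
Qed.

(** * Existence of the minima and maxima *)

Lemma nat_minP (A : set nat) :
  (A !=set0)%classic -> A (nat_min A) /\ forall n, A n -> (nat_min A <= n)%N.
Proof.
case=> a Aa; have exA : exists n, `[< A n >] by exists a; apply/asboolP.
have [Am lbm] : (A `&` lbound A)%classic (nat_min A).
  apply: xgetPex; case: (ex_minnP exA) => m /asboolP Am min_m; exists m.
  by split=> // n An; apply/min_m/asboolP.
by split=> // n /lbm.
Qed.

(** The bound [N] rules out the default value 0 of [nat_max] on unbounded sets. *)
Lemma leq_nat_max (A : set nat) (N : nat) :
  (forall n, A n -> (n <= N)%N) -> forall n, A n -> (n <= nat_max A)%N.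
Proof.
move=> leA n An; have exA : exists n, `[< A n >] by exists n; apply/asboolP.
have [_ ubm] : (A `&` ubound A)%classic (nat_max A); last exact: ubm.
apply: xgetPex; case: (@ex_maxnP _ N exA) => [p /asboolP /leA //|m /asboolP Am max_m].
by exists m; split=> // p Ap; apply/max_m/asboolP.
Qed.

(** * Word length of the commutator tree *)

Section WordLength.
Variables (G : groupType) (S : set G).
Hypothesis genS : generates S.
Implicit Types g h a b u v : G.

Lemma word_lengthP g :
  exists s, [/\ size s = word_length S g, word_over S s & \prod_(x <- s) x = g].
Proof. by have [] := nat_minP (genS g). Qed.

Lemma word_length_le s :
  word_over S s -> (word_length S (\prod_(x <- s) x) <= size s)%N.
Proof. by move=> Ss; have [_] := nat_minP (genS (\prod_(x <- s) x)); apply; exists s. Qed.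

Lemma word_length1 : word_length S 1 = 0.
Proof. by have := @word_length_le [::]; rewrite big_nil /= leqn0 => /(_ _)/eqP; apply. Qed.

Lemma word_lengthM g h :
  (word_length S (g * h) <= word_length S g + word_length S h)%N.
Proof.
have [s [<- Ss <-]] := word_lengthP g; have [t [<- St <-]] := word_lengthP h.
rewrite -size_cat -big_cat; apply: word_length_le => x.
by rewrite mem_cat => /orP[/Ss|/St].
Qed.

Lemma word_lengthV g : (word_length S g^-1 <= word_length S g)%N.
Proof.
have [s [<- Ss <-]] := word_lengthP g.
have -> : (\prod_(x <- s) x)^-1 = \prod_(x <- rev (map (@invg G) s)) x.
  elim: s {Ss} => [|x s IHs]; first by rewrite !big_nil invg1.
  by rewrite big_cons invgM IHs /= rev_cons big_rcons.
rewrite -(size_map (@invg G)) -size_rev; apply: word_length_le => x.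
by rewrite mem_rev => /mapP[y /Ss Sy ->]; rewrite invgK; apply/or_comm.
Qed.

Lemma word_lengthX g n : (word_length S (g ^+ n) <= n * word_length S g)%N.
Proof.
elim: n => [|n IHn]; first by rewrite word_length1.
by rewrite expgS mulSn; apply: leq_trans (word_lengthM _ _) _; rewrite leq_add2l.
Qed.

Lemma word_length_cword a b u v c :
  (word_length S a <= c)%N -> (word_length S b <= c)%N ->
  (word_length S (cword a b u v)
     <= 2 * word_length S u + 2 * word_length S v + 6 * c)%N.
Proof.
move=> la lb; have laV := leq_trans (word_lengthV a) la.
have lbV := leq_trans (word_lengthV b) lb.
have lM x y m n : (word_length S x <= m)%N -> (word_length S y <= n)%N ->
    (word_length S (x * y) <= m + n)%N.
  by move=> lx ly; apply: leq_trans (word_lengthM _ _) (leq_add lx ly).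
set lu := word_length S u; set lv := word_length S v.
suff lw : (word_length S (cword a b u v)
    <= c + (lu + (c + (lv + (c + (lu + (c + (lv + (c + c)))))))))%N by lia.
have luV := word_lengthV u; have lvV := word_lengthV v.
by do 9![apply: (lM) => //].
Qed.

(** The added [2 * c] absorbs the [6 * c] of [word_length_cword], because [6 + 2 = 2 * 2 + 2 * 2].
    The largest exponent at a leaf is [r + 2 ^ d]. *)
Lemma word_length_ctree a b c d r :
  (word_length S a <= c)%N -> (word_length S b <= c)%N ->
  (word_length S (ctree a b d r) + 2 * c
     <= 4 ^ d * (2 * c * (r + 2 ^ d) + 10 * c))%N.
Proof.
move=> la lb; elim: d r => [|d IHd] r /=.
  have := word_length_cword (a ^+ r.+1) a la lb.
  have : (word_length S (a ^+ r.+1) <= r.+1 * c)%N.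
    by apply: leq_trans (word_lengthX _ _) _; rewrite leq_mul2l la orbT.
  nia.
have := word_length_cword (ctree a b d r) (ctree a b d (r + 2 ^ d)) la lb.
have := IHd r; have := IHd (r + 2 ^ d)%N; rewrite !expnS.
nia.
Qed.
End WordLength.

(** * Lower bound for the growth function *)

Section FreeGroupGrowth.
Variables (k : nat) (S : set (free_group k)).
Hypotheses (finS : finite_set S) (genS : generates S).

Lemma size_rmul_le (s t : seq (letter k)) : (size (rmul s t) <= size s + size t)%N.
Proof.
elim: s => // x s IHs /=; case: (rmul s t) IHs => //= y r.
by case: ifP => /= _; lia.
Qed.

Lemma size_le_word_length :
  exists M, forall w : free_group k, (size w <= M * word_length S w)%N.
Proof.
have /finite_seqP[T eqS] := finS.
exists (\max_(x <- T) size x) => w; set M := \max_(x <- T) _.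
have SM x : S x \/ S x^-1 -> (size x <= M)%N.
  have SM' y : S y -> (size y <= M)%N by rewrite eqS => Ty; exact: leq_bigmax_seq.
  by case=> [/SM' //|/SM']; rewrite /= size_rev size_map.
have [s [<- Ss <-]] := word_lengthP genS w; elim: s Ss => [|x s IHs] Ss.
  by rewrite big_nil muln0.
rewrite big_cons /= mulnS; apply: leq_trans (size_rmul_le _ _) _.
rewrite leq_add ?SM ?IHs //; first by apply: Ss; rewrite mem_head.
by move=> y sy; apply: Ss; rewrite in_cons sy orbT.
Qed.

Lemma detection_le_rf_growth (w : free_group k) n :
  w <> 1 -> (word_length S w <= n)%N -> (detection w <= rf_growth S n)%N.
Proof.
move=> w1 wn; have [M sizeM] := size_le_word_length.
(* Reduced length is at most [M * n] here, so a symmetric group on at most [(M * n).+1] points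
   detects each competing word. *)
apply: (@leq_nat_max _ (M * n).+1`!); last by exists w.
move=> _ [v [v1 vn] <-].
have [_ /(_ _ (free_group_detection v1)) /leq_trans] :=
  nat_minP (ex_intro _ _ (free_group_detection v1)).
apply; rewrite leq_fact // ltnS (leq_trans (sizeM v)) // leq_mul2l vn orbT //.
Qed.

(** A homomorphism maps the tree to the tree on the images of the generators, which is trivial in
    groups of order at most [4 ^ d]. *)
Lemma ctree_detection_gt (i j : 'I_k) d :
  i != j -> (4 ^ d < detection (ctree (fg_gen i) (fg_gen j) d 0))%N.
Proof.
move=> ij; have w1 := @ctree_gen_neq1 k i j d 0 ij.
have [[H [pi [cardH pw1]] _]] := nat_minP (ex_intro _ _ (free_group_detection w1)).
rewrite /detection -cardH ltnNge; apply/negP => leH.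
by apply: pw1; rewrite ctree_morph ctree_finite_eq1.
Qed.

Lemma rf_growth_gt : (2 <= k)%N ->
  exists c, forall d n, (c * 8 ^ d <= n)%N -> (4 ^ d < rf_growth S n)%N.
Proof.
move=> hk; pose i : 'I_k := Ordinal (ltnW hk); pose j : 'I_k := Ordinal hk.
pose c := maxn (word_length S (fg_gen i)) (word_length S (fg_gen j)).
(* At [r = 0] the length is at most [4 ^ d * (2 * c * 2 ^ d + 10 * c)], and [1 <= 2 ^ d]. *)
exists (12 * c)%N => d n le_n; apply: leq_trans (@ctree_detection_gt i j d _) _ => //.
apply: detection_le_rf_growth; first exact: ctree_gen_neq1.
apply: leq_trans le_n; have := word_length_ctree genS d 0 (leq_maxl _ _ : (_ <= c)%N) (leq_maxr _ _).
rewrite -[8%N]/(2 * 4)%N expnMn => /(leq_trans (leq_addr _ _)) /leq_trans; apply.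
have := expn_gt0 2 d; nia.
Qed.
End FreeGroupGrowth.
Import Order.TTheory GRing.Theory Num.Theory.
Local Open Scope ring_scope.

Theorem theorem1 (R : realType) (k : nat) (hk : (2 <= k)%N)
    (S : set (free_group k)) (finS : finite_set S) (genS : generates S) :
  exists C : nat, (0 < C)%N /\
    forall n : nat, (1 <= n)%N ->
      (n%:R : R) `^ (2%:R / 3%:R) <= C%:R * (rf_growth S (C * n))%:R.
Proof.
have [c growth] := rf_growth_gt finS genS hk.
(* With [8 ^ d <= n < 8 ^ d.+1], the summand [c] makes the argument reach [c * 8 ^ d], and the 4
   pays for rounding [n] up, as [n ^ (2/3) <= 4 * 4 ^ d]. *)
exists (c + 4)%N; split=> [|n n_gt0]; first by rewrite addn4.
have /andP[le_n lt_n] := trunc_log_bounds (isT : (1 < 8)%N) n_gt0.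
set d := trunc_log 8 n in le_n lt_n.
have lt_F : (4 ^ d < rf_growth S ((c + 4) * n))%N.
  by apply: growth; apply: leq_mul; rewrite ?leq_addr.
have pow23 : (8 ^ d.+1)%:R `^ (2%:R / 3%:R) = (4 ^ d.+1)%:R :> R.
  rewrite -[8%N]/(2 ^ 3)%N -[4%N]/(2 ^ 2)%N -!expnM !natrX -!powR_mulrn ?ler0n //.
  by rewrite -powRrM; congr (_ `^ _); rewrite !natrM; field.
have le4 : n%:R `^ (2%:R / 3%:R) <= (4 ^ d.+1)%:R :> R.
  by rewrite -pow23 ge0_ler_powR ?nnegrE ?ler0n ?divr_ge0 ?ler_nat // ltnW.
apply: (le_trans le4); rewrite -natrM ler_nat expnS;
by apply: leq_mul; [exact: leq_addl | exact: ltnW].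
Qed.
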